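(* For all integers $n,m\geq 4$, $s_6(P_n\square P_m)=4$.
   Context: $P_k$ denotes the path on $k$ vertices, and $\square$ denotes the Cartesian product of graphs. A $P_k$-coloring of a graph $G$ is a proper vertex coloring of $G$ in which no copy of $P_k$ in $G$ (as a subgraph, not necessarily induced) is bicolored, i.e. has its vertices colored using only two colors. The $P_k$-chromatic number $s_k(G)$ is the minimum number of colors in a $P_k$-coloring of $G$. *)

(* Defs.v *)
From mathcomp Require Import all_boot.

Set Implicit Arguments.
Unset Strict Implicit.
Unset Printing Implicit Defensive.

Record sgraph := SGraph {
  vertex :> finType;
  adj : rel vertex;
  adj_sym : symmetric adj;
  adj_irrefl : irreflexive adj
}.

Definition path_adj k : rel 'I_k := fun i j => (i.+1 == j) || (j.+1 == i).

Lemma path_adj_sym k : symmetric (@path_adj k).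
Proof. by move=> i j; rewrite /path_adj orbC. Qed.

Lemma path_adj_irrefl k : irreflexive (@path_adj k).
Proof. by move=> i; rewrite /path_adj orbb gtn_eqF. Qed.

Definition path_graph k := SGraph (@path_adj_sym k) (@path_adj_irrefl k).

Definition cart_adj (G H : sgraph) : rel (G * H) := fun u v =>
  ((u.1 == v.1) && adj u.2 v.2) || ((u.2 == v.2) && adj u.1 v.1).

Lemma cart_adj_sym G H : symmetric (@cart_adj G H).
Proof.
move=> u v; rewrite /cart_adj [u.1 == _]eq_sym [u.2 == _]eq_sym.
by rewrite [adj u.1 _]adj_sym [adj u.2 _]adj_sym.
Qed.

Lemma cart_adj_irrefl G H : irreflexive (@cart_adj G H).
Proof. by move=> u; rewrite /cart_adj !adj_irrefl !andbF. Qed.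

Definition cart_prod G H := SGraph (@cart_adj_sym G H) (@cart_adj_irrefl G H).

Notation "G □ H" := (cart_prod G H) (at level 40, left associativity).

Definition proper_coloring (G : sgraph) q (c : {ffun G -> 'I_q}) : bool :=
  [forall u, forall v, adj u v ==> (c u != c v)].

(* A copy of H in G as a not necessarily induced subgraph: adjacency is
   preserved by f, but need not be reflected. *)
Definition is_copy (H G : sgraph) (f : {ffun H -> G}) : bool :=
  injectiveb f && [forall x, forall y, adj x y ==> adj (f x) (f y)].

Definition bicolored (H G : sgraph) q (c : {ffun G -> 'I_q})
    (f : {ffun H -> G}) : bool :=
  #|[set c (f x) | x : H]| <= 2.

Definition Pk_coloring k (G : sgraph) q (c : {ffun G -> 'I_q}) : bool :=
  proper_coloring c &&
  [forall f : {ffun path_graph k -> G}, is_copy f ==> ~~ bicolored c f].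

Definition Pk_colorable k (G : sgraph) q : bool :=
  [exists c : {ffun G -> 'I_q}, Pk_coloring k c].

(* For k >= 3 a coloring with pairwise distinct colors is a P_k-coloring, so
   the minimum exists and is at most the order of G: it suffices to minimize
   over q <= #|G|. For k < 3 there may be no P_k-coloring, and the value is
   then the default #|G|. *)
Definition Pk_chromatic_number k (G : sgraph) : nat :=
  [arg min_(q < ord_max : 'I_#|G|.+1 | Pk_colorable k G q) (q : nat)].

Lemma Pk_colorable_card k (G : sgraph) : 2 < k -> Pk_colorable k G #|G|.
Proof.
move=> k_gt2; apply/existsP; exists [ffun u => enum_rank u]; apply/andP; split.
  apply/'forall_forallP => u v; apply/implyP => uv; rewrite !ffunE.
  by apply: contraTneq uv => /enum_rank_inj->; rewrite adj_irrefl.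
apply/forallP => f; apply/implyP => /andP[/injectiveP f_inj _].
rewrite /bicolored card_imset ?card_ord -?ltnNge //.
by move=> x y; rewrite !ffunE => /enum_rank_inj/f_inj.
Qed.

Lemma Pk_chromatic_numberP k (G : sgraph) : 2 < k ->
  Pk_colorable k G (Pk_chromatic_number k G) /\
  (forall q, Pk_colorable k G q -> Pk_chromatic_number k G <= q).
Proof.
move=> k_gt2; rewrite /Pk_chromatic_number.
case: arg_minnP => [|q q_col q_min]; first exact: Pk_colorable_card.
split=> // r r_col; have [le_rG|lt_Gr] := leqP r #|G|.
  exact: (q_min (Ordinal (le_rG : r < #|G|.+1))).
by apply: leq_trans (ltnW lt_Gr); rewrite -ltnS.
Qed.

(* Main.v *)
(** For the upper bound, [(i, j) |-> i + 2j mod 8] maps the grid to the circulant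
    graph C_8(1,2) and is injective on the neighbours of each vertex. Hence a
    bicolored path of the grid, colored through this map, projects to a bicolored
    walk without backtracking of C_8(1,2), and the chosen coloring of C_8(1,2) has
    no such walk with six vertices.

    For the lower bound, the grid has a 4 x 4 subgrid, and a backtracking search
    shows that each proper 3-coloring of it has a bicolored P_6. *)

Require Import Defs.
From mathcomp Require Import all_boot.
From mathcomp Require Import zify.

Set Implicit Arguments.
Unset Strict Implicit.
Unset Printing Implicit Defensive.

(** * Colorings tested on sequences of vertices *)

Lemma card_imset_undup (T T' : finType) (f : T -> T') :
  #|[set f x | x : T]| = size (undup [seq f x | x <- enum T]).
Proof.
rewrite -(card_uniqP (undup_uniq _)); apply: eq_card => y; rewrite mem_undup.
apply/imsetP/mapP => -[x _ ->]; exists x => //; exact: mem_enum.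
Qed.

(** Replaces functions on ordinals by sequences, which suit induction and computation. The form
    [k.+1] makes the path nonempty, so that default vertices for [nth] exist. *)
Lemma Pk_coloringP k (G : sgraph) q (c : {ffun G -> 'I_q}) :
  reflect ((forall u v, adj u v -> c u != c v) /\
           (forall p : seq G, size p = k.+1 -> sorted (@adj G) p -> uniq p ->
              2 < size (undup [seq c u | u <- p])))
          (Pk_coloring k.+1 c).
Proof.
apply: (iffP andP) => -[c_proper c_paths]; split.
- by move=> u v; move/'forall_forallP: c_proper => /(_ u v)/implyP.
- move=> p sz_p p_path p_uniq.
  have [x0 _] : exists x0, x0 \in p.
    by case: p sz_p {p_path p_uniq} => // x s _; exists x; exact: mem_head.
  pose f : {ffun path_graph k.+1 -> G} := [ffun i : 'I_k.+1 => nth x0 p i].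
  have f_copy : is_copy f.
    apply/andP; split.
      apply/injectiveP => i j; rewrite !ffunE => /eqP.
      by rewrite nth_uniq ?sz_p // => /eqP/val_inj.
    have step (i j : 'I_k.+1) : i.+1 == j -> adj (nth x0 p i) (nth x0 p j).
      by move/eqP=> ij; rewrite -ij; apply: (sortedP x0 p_path); rewrite ij sz_p.
    apply/'forall_forallP => i j; apply/implyP; rewrite !ffunE.
    by case/orP => /step //; rewrite adj_sym.
  move/forallP/(_ f)/implyP/(_ f_copy): c_paths.
  rewrite /bicolored -ltnNge card_imset_undup.
  have -> // : [seq c (f x) | x <- enum 'I_k.+1] = [seq c u | u <- p].
  rewrite -[p in RHS](mkseq_nth x0) sz_p /mkseq -val_enum_ord -!map_comp.
  by apply: eq_map => i; rewrite /= ffunE.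
- by apply/'forall_forallP => u v; apply/implyP; exact: c_proper.
- apply/forallP => f; apply/implyP => /andP[/injectiveP f_inj f_adj].
  rewrite /bicolored -ltnNge card_imset_undup.
  have sz_e : size (enum (path_graph k.+1)) = k.+1 := size_enum_ord _.
  have nth_e i : i < k.+1 -> nth ord0 (enum (path_graph k.+1)) i = i :> nat.
    exact: nth_enum_ord.
  move: (enum_uniq (path_graph k.+1)) sz_e nth_e.
  move: (enum (path_graph k.+1)) => e e_uniq sz_e nth_e.
  rewrite (map_comp c f); apply: c_paths; rewrite ?size_map ?map_inj_uniq //.
  apply/(sortedP (f ord0)) => i; rewrite size_map sz_e => lt_i.
  rewrite !(nth_map ord0) ?sz_e ?(ltnW lt_i) //.
  move/'forall_forallP: f_adj => /(_ _ _)/implyP; apply.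
  by apply/orP; left; rewrite !nth_e ?(ltnW lt_i).
Qed.

Lemma few_colors_alternate (T : eqType) (a b d : T) s :
  a != b -> b != d -> size (undup [:: a, b, d & s]) <= 2 -> a = d.
Proof.
move=> ab bd; apply: contraTeq => ad; rewrite -ltnNge.
apply: (@uniq_leq_size _ [:: a; b; d]) => [|x].
  by rewrite /= !inE negb_or ab ad bd.
by rewrite mem_undup !inE => /or3P[]->; rewrite ?orbT.
Qed.

Lemma size_undup_cons (T : eqType) (x : T) s :
  size (undup s) <= size (undup (x :: s)).
Proof. by rewrite /=; case: ifP. Qed.

(** * The 4-coloring *)

(** The differences 6 and 7 are -2 and -1 modulo 8. *)
Definition circ_adj r s := has (fun d => s == (r + d) %% 8) [:: 1; 2; 6; 7].

(** Each color is used on two residues, at circular distance 3 or 4. *)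
Definition circ_color r := nth 0 [:: 0; 1; 2; 0; 3; 1; 2; 3] r.

Fixpoint alternating_walk k r s :=
  if k is k'.+1 then
    has (fun t => [&& circ_adj s t, t != r, circ_color t == circ_color r
                    & alternating_walk k' s t]) (iota 0 8)
  else true.

Lemma circ_color_lt r : circ_color r < 4.
Proof. by do 9?[case: r => [|r]]. Qed.

Lemma circ_color_proper r s :
  r < 8 -> circ_adj r s -> circ_color r != circ_color s.
Proof. by do 8?[case: r => [|r]] => // _ /or4P[/eqP->|/eqP->|/eqP->|/orP[/eqP->|]]. Qed.

(** Each color class has two residues, so such a walk would be forced to run r, s, r', s', r, s
    around a bicolored 4-cycle, and no two classes span one. The 64 starts are checked by
    computation. *)
Lemma no_alternating_walk r s : r < 8 -> s < 8 -> ~~ alternating_walk 4 r s.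
Proof. by do 8?[case: r => [|r]] => // _; do 8?[case: s => [|s]]. Qed.

Section GridColoring.

Variables n m : nat.
Local Notation G := (path_graph n □ path_graph m).

Definition residue (u : G) := ((u.1 : 'I_n) + 2 * (u.2 : 'I_m)) %% 8.

Lemma grid_adjP (u v : G) :
  reflect ((u.1 : 'I_n) = (v.1 : 'I_n) :> nat /\
             ((u.2 : 'I_m).+1 = (v.2 : 'I_m) \/ (v.2 : 'I_m).+1 = (u.2 : 'I_m)) \/
           (u.2 : 'I_m) = (v.2 : 'I_m) :> nat /\
             ((u.1 : 'I_n).+1 = (v.1 : 'I_n) \/ (v.1 : 'I_n).+1 = (u.1 : 'I_n)))
          (adj u v).
Proof.
case: u v => [i j] [i' j']; rewrite /= /cart_adj /= /path_adj -!(inj_eq val_inj) /=.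
by apply: (iffP idP); lia.
Qed.

Lemma residue_adj (u v : G) : adj u v -> circ_adj (residue u) (residue v).
Proof. by move/grid_adjP; rewrite /circ_adj /residue /=; lia. Qed.

(** The neighbours of [v] shift its residue by 1, -1, 2 or -2, which are distinct modulo 8. *)
Lemma residue_local_inj (u v w : G) :
  adj u v -> adj v w -> residue w = residue u -> w = u.
Proof.
case: u v w => [i j] [i' j'] [i'' j''] /grid_adjP uv /grid_adjP vw.
rewrite /residue /= in uv vw * => eq_r.
by congr (_, _); apply: val_inj => /=; lia.
Qed.

Definition grid_color : {ffun G -> 'I_4} :=
  [ffun u => Ordinal (circ_color_lt (residue u))].

Lemma grid_color_proper (u v : G) : adj u v -> grid_color u != grid_color v.
Proof.
move=> /residue_adj; rewrite !ffunE -(inj_eq val_inj) /=.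
by apply: circ_color_proper; rewrite ltn_pmod.
Qed.

Lemma bicolored_path_alternating (u v : G) p :
  sorted (@adj G) [:: u, v & p] -> uniq [:: u, v & p] ->
  size (undup [seq grid_color x | x <- [:: u, v & p]]) <= 2 ->
  alternating_walk (size p) (residue u) (residue v).
Proof.
elim: p u v => // w p IHp u v p_path p_uniq few.
have /and3P[uv vw wp] := p_path; have /andP[u_notin vp_uniq] := p_uniq.
apply/hasP; exists (residue w); first by rewrite mem_iota ltn_pmod.
apply/and4P; split; first exact: residue_adj.
- apply: contraNneq u_notin => /(residue_local_inj uv vw)->.
  by rewrite !inE eqxx orbT.
- have := few_colors_alternate (grid_color_proper uv) (grid_color_proper vw) few.
  by move/(congr1 val); rewrite !ffunE /= => ->.
- apply: IHp => //; first by apply/andP.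
  exact: leq_trans (size_undup_cons _ _) few.
Qed.

Lemma grid_colorable4 : Pk_colorable 6 G 4.
Proof.
apply/existsP; exists grid_color; apply/Pk_coloringP; split.
  exact: grid_color_proper.
move=> [|u [|v p]] // [sz_p] p_path p_uniq; rewrite ltnNge; apply/negP => few.
have := bicolored_path_alternating p_path p_uniq few.
(* Six vertices leave four steps after the first edge. *)
by rewrite sz_p (negPf (no_alternating_walk _ _)) // ltn_pmod.
Qed.

End GridColoring.

(** * No 3-coloring of the 4 x 4 grid *)

(* The vertex (i, j) of the 4 x 4 grid is encoded as 4i + j. *)
Definition code_adj x y :=
  ((x %/ 4 == y %/ 4) && ((x.+1 == y) || (y.+1 == x))) ||
  ((x + 4 == y) || (y + 4 == x)).

Definition extend_path (p : seq nat) :=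
  [seq y :: p | y <- iota 0 16 & code_adj y (head 0 p) && (y \notin p)].

Definition code_paths k :=
  iter k (fun ps => flatten (map extend_path ps)) [seq [:: x] | x <- iota 0 16].

Lemma code_pathsP k p : p \in code_paths k ->
  [/\ size p = k.+1, sorted code_adj p, uniq p & all (gtn 16) p].
Proof.
elim: k p => [|k IHk] p.
  by case/mapP=> x; rewrite mem_iota => /= lt_x ->; rewrite /= lt_x.
case/flatten_mapP=> s /IHk[sz_s s_path s_uniq s_lt] /mapP[y].
rewrite mem_filter mem_iota /= => /andP[/andP[y_adj y_notin] y_lt] ->.
rewrite /= sz_s y_notin s_uniq y_lt s_lt; split=> //.
by case: s sz_s s_path y_adj {s_uniq s_lt y_notin} => //= a s _ -> ->.
Qed.

(* [w] lists the colors of the vertices 0, ..., size w - 1. These definitions use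
   [if] because [&&] and [||] evaluate both arguments under [vm_compute]. *)
Definition few_colors (w : seq nat) (pb : seq nat * nat) :=
  if all (gtn (size w)) pb.1
  then size (undup [seq nth 0 w x | x <- pb.1]) <= pb.2 else false.

Fixpoint refute q (cs : seq (seq nat * nat)) k w :=
  if has (few_colors w) cs then true
  else if k is k'.+1 then all (fun a => refute q cs k' (rcons w a)) (iota 0 q)
  else false.

(** At each node the search is followed into the branch [c l], so the word stays a prefix of [c];
    the constraint that closes this branch is violated by [c] itself. *)
Lemma refute_sound q cs (c : nat -> nat) k l : (forall x, c x < q) ->
  refute q cs k (mkseq c l) ->
  exists2 pb, pb \in cs & size (undup [seq c x | x <- pb.1]) <= pb.2.
Proof.
move=> c_lt; elim: k l => [|k IHk] l /=; case: ifPn => //; last first.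
  move=> _ /allP/(_ (c l)); rewrite mem_iota c_lt -mkseqS => /(_ isT).
  exact: IHk.
all: move=> /hasP[[p b] pb_cs]; rewrite /few_colors size_mkseq.
all: case: ifP => // /allP p_lt few _; exists (p, b) => //=.
all: congr (size (undup _) <= b): few; apply/eq_in_map => x /p_lt.
all: exact: nth_mkseq.
Qed.

(* Two adjacent vertices may not share one color, nor six on a path two colors. *)
Definition constraints :=
  [seq (p, 1) | p <- code_paths 1] ++ [seq (p, 2) | p <- code_paths 5].

Lemma refute3 : refute 3 constraints 16 [::].
Proof. by vm_compute. Qed.

Section LowerBound.

Variables n m : nat.
Hypotheses (n_ge4 : 4 <= n) (m_ge4 : 4 <= m).
Local Notation G := (path_graph n □ path_graph m).

(** For codes below 16 both arguments of [inord] are below 4, so its default never occurs. *)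
Definition decode x : G :=
  (widen_ord n_ge4 (inord (x %/ 4)), widen_ord m_ge4 (inord (x %% 4))).

Lemma decode_inj : {in gtn 16 &, injective decode}.
Proof.
move=> x y; rewrite !inE => lt_x lt_y [].
by rewrite !inordK; lia.
Qed.

Lemma decode_adj :
  {in gtn 16 &, forall x y, code_adj x y -> adj (decode x) (decode y)}.
Proof.
move=> x y; rewrite !inE /code_adj => lt_x lt_y xy; apply/grid_adjP.
by rewrite /= !inordK; lia.
Qed.

Lemma grid_not_colorable3 q : Pk_colorable 6 G q -> 3 < q.
Proof.
case/existsP=> c /Pk_coloringP[c_proper c_paths]; rewrite ltnNge; apply/negP => le_q.
(* Colors become natural numbers, so that one search with three colors covers every [q <= 3]. *)
pose col x : nat := c (decode x).
have undup_col p : size (undup [seq col x | x <- p]) =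
    size (undup [seq c u | u <- [seq decode x | x <- p]]).
  by rewrite -map_comp (map_comp val) undup_map_inj ?size_map //; exact: val_inj.
have [||pb] := @refute_sound 3 constraints col 16 0.
- by move=> x; exact: leq_trans (ltn_ord _) le_q.
- exact: refute3.
have decode_path k p : p \in code_paths k ->
    [/\ size (map decode p) = k.+1, sorted (@adj G) (map decode p)
      & uniq (map decode p)].
  case/code_pathsP=> sz_p p_path p_uniq /allP p_lt; split.
  - by rewrite size_map.
  - rewrite sorted_map; apply: (sub_in_sorted decode_adj) p_path; exact/allP.
  - rewrite map_inj_in_uniq // => x y /p_lt lt_x /p_lt lt_y.
    exact: decode_inj.
rewrite mem_cat => /orP[] /mapP[p /decode_path[sz_p p_path p_uniq] ->];
  rewrite undup_col /=.
(* An edge in one color contradicts properness; a six-vertex path in two colors contradicts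
   [c_paths]. *)
- case: (map decode p) sz_p p_path {p_uniq} => [|u [|v []]] //= _ /andP[uv _].
  by rewrite inE (negPf (c_proper _ _ uv)).
- by rewrite leqNgt c_paths.
Qed.

End LowerBound.

Theorem corollary13 (n m : nat) (hn : 4 <= n) (hm : 4 <= m) :
  Pk_chromatic_number 6 (path_graph n □ path_graph m) = 4.
Proof.
have [//|colorable minimal] :=
  @Pk_chromatic_numberP 6 (path_graph n □ path_graph m).
apply/eqP; rewrite eqn_leq minimal ?grid_colorable4 //.
exact: grid_not_colorable3 colorable.
Qed.
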